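(* Let $G$ be a subgroup of Thompson's group $V$ that acts $2$-fold transitively on the set of proper cones of $\mathfrak{C}$. Then $G=V$.
   Context: $\mathfrak{C}$ is the Cantor space of infinite words over $\{0,1\}$ and $\Omega$ is the set of all finite words over $\{0,1\}$ (including the empty word), called addresses. For $\alpha\in\Omega$ the cone is $\alpha\mathfrak{C}=\{\alpha w\mid w\in\mathfrak{C}\}$. Thompson's group $V$ is the group (under composition) of all maps $\mathfrak{C}\to\mathfrak{C}$ for which there are two partitions $\alpha_1\mathfrak{C},\dots,\alpha_n\mathfrak{C}$ and $\beta_1\mathfrak{C},\dots,\beta_n\mathfrak{C}$ of $\mathfrak{C}$ into disjoint cones such that $\alpha_iw\mapsto\beta_iw$ for all $i$ and all $w\in\mathfrak{C}$. $V$ acts partially on $\Omega$ on the right: $\alpha^g=\beta$ if $g$ maps $\alpha w\mapsto\beta w$ for all $w\in\mathfrak{C}$; if there is no such $\beta$, then $\alpha^g$ is undefined. For a positive integer $k$, let $\Sigma_k$ be the set of all $(\alpha_1,\dots,\alpha_k)\in\Omega^k$ such that $\alpha_i\mathfrak{C}\cap\alpha_j\mathfrak{C}=\varnothing$ for all $i\neq j$ and $\bigcup_{i=1}^k\alpha_i\mathfrak{C}\neq\mathfrak{C}$. A subgroup $G\le V$ acts $k$-fold transitively on proper cones if for all $(\alpha_1,\dots,\alpha_k),(\beta_1,\dots,\beta_k)\in\Sigma_k$ there is $g\in G$ such that $\alpha_i^g$ is defined and $\alpha_i^g=\beta_i$ for $i=1,\dots,k$. *)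

(* Defs.v *)
From mathcomp Require Import all_boot.
From mathcomp Require Import boolp classical_sets.
From mathcomp Require Import cantor.

Set Implicit Arguments.
Unset Strict Implicit.
Unset Printing Implicit Defensive.

Local Open Scope classical_set_scope.

Definition address := seq bool.

(* The infinite word [a w]. *)
Definition prepend (a : address) (w : cantor_space) : cantor_space :=
  fun n => if n < size a then nth false a n else w (n - size a).

Definition cone (a : address) : set cantor_space := range (prepend a).

(* The partial right action on addresses, as a relation: [a^g] is defined and
   equal to [b]. Such a [b] is unique when it exists. *)
Definition addr_act (g : cantor_space -> cantor_space) (a b : address) : Prop :=
  forall w : cantor_space, g (prepend a w) = prepend b w.

Definition thompsonV : set (cantor_space -> cantor_space) :=
  [set g | exists (n : nat) (a b : 'I_n -> address),
    [/\ partition [set: 'I_n] (cone \o a) [set: cantor_space],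
        partition [set: 'I_n] (cone \o b) [set: cantor_space]
      & forall i, addr_act g (a i) (b i)]].

Definition subgroup_of_V (G : set (cantor_space -> cantor_space)) : Prop :=
  [/\ G `<=` thompsonV,
      G id,
      forall g h, G g -> G h -> G (g \o h)
    & forall g, G g -> exists2 h, G h & cancel g h /\ cancel h g].

Definition Sigma (k : nat) : set ('I_k -> address) :=
  [set a | trivIset [set: 'I_k] (cone \o a) /\
           \bigcup_i cone (a i) <> [set: cantor_space]].

Definition transitive_on_proper_cones (k : nat)
    (G : set (cantor_space -> cantor_space)) : Prop :=
  forall a b : 'I_k -> address, Sigma a -> Sigma b ->
    exists2 g, G g & forall i, addr_act g (a i) (b i).

(* Main.v *)
(** Two-fold transitivity upgrades to three-fold transitivity on triples of cones
one of which can be shrunk inside a larger cone disjoint from the other two: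
an element of [G] moving the other two cones maps some deep subcone of the
larger cone to a cone, and elements of [G] supported in a proper cone permute
its subcones transitively.  Hence [G] contains an element swapping the cones 11
and 100 and fixing 0 pointwise, and one swapping 11 and 00 and fixing 10
pointwise.  Outside the cones 11, 100 and 00 they have disjoint supports, so
their commutator is exactly a 3-cycle of cones.  Products of conjugates of this
3-cycle give the swaps of two disjoint cones, and these generate [V]: composing
with swaps turns the images of two sibling cones into siblings, after which the
two pieces merge. *)

Require Import Defs.
From mathcomp Require Import all_boot.
From mathcomp Require Import boolp classical_sets.
From mathcomp Require Import cantor.

Set Implicit Arguments.
Unset Strict Implicit.
Unset Printing Implicit Defensive.

(** * Infinite words, cones and disjoint addresses *)

Definition ltail (n : nat) (w : cantor_space) : cantor_space :=
  fun i => w (n + i).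

(** A boolean form of [cone], so that membership can be counted and settled by cases on the first
    letters. *)
Definition in_cone (a : address) (w : cantor_space) : bool :=
  mkseq w (size a) == a.

Definition zeros : cantor_space := fun=> false.

Definition disj (a b : address) : Prop :=
  forall w, ~~ (in_cone a w && in_cone b w).

Lemma prepend_nil w : prepend [::] w = w.
Proof. by apply/funext => n; rewrite /prepend /= subn0. Qed.

Lemma prepend_cat a b w : prepend (a ++ b) w = prepend a (prepend b w).
Proof.
apply/funext => n; rewrite /prepend size_cat nth_cat.
case: (ltnP n (size a)) => an; first by rewrite ltn_addr.
by rewrite ltn_subLR // subnDA.
Qed.

Lemma ltail_prepend a w : ltail (size a) (prepend a w) = w.
Proof.
by apply/funext => i; rewrite /ltail /prepend ltnNge leq_addr /= addKn.
Qed.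

Lemma in_coneP a w : reflect (exists u, w = prepend a u) (in_cone a w).
Proof.
apply: (iffP eqP) => [e|[u ->]].
  exists (ltail (size a) w); apply/funext => n; rewrite /prepend /ltail.
  by case: ltnP => an; [rewrite -e nth_mkseq | rewrite subnKC].
apply: (@eq_from_nth _ false); rewrite size_mkseq // => i ia.
by rewrite nth_mkseq // /prepend ia.
Qed.

Lemma in_cone_prepend a u : in_cone a (prepend a u).
Proof. by apply/in_coneP; exists u. Qed.

Lemma prependK a w : in_cone a w -> prepend a (ltail (size a) w) = w.
Proof. by case/in_coneP => u ->; rewrite ltail_prepend. Qed.

Lemma in_cone_cat a b w :
  in_cone (a ++ b) w = in_cone a w && in_cone b (ltail (size a) w).
Proof.
apply/in_coneP/andP => [[u ->]|[/in_coneP[v ->]]].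
  by rewrite prepend_cat in_cone_prepend ltail_prepend in_cone_prepend.
by rewrite ltail_prepend => /in_coneP[u ->]; exists u; rewrite prepend_cat.
Qed.

Lemma in_cone1 x w : in_cone [:: x] w = (w 0 == x).
Proof. by rewrite /in_cone /= eqseq_cons andbT. Qed.

Lemma in_cone_prefix a b w : size a <= size b ->
  in_cone a w -> in_cone b w -> prefix a b.
Proof.
move=> ab /eqP <- /eqP <-; apply/prefixP.
exists (mkseq (ltail (size a) w) (size b - size a)).
rewrite /mkseq -{1}(subnKC ab) iotaD map_cat; congr (_ ++ _).
by rewrite add0n -[X in iota X _]addn0 iotaDl -map_comp.
Qed.

Lemma disjC a b : disj a b -> disj b a.
Proof. by move=> ab w; rewrite andbC. Qed.

Lemma disj_in a b w : disj a b -> in_cone a w -> in_cone b w = false.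
Proof. by move=> /(_ w) + aw; rewrite aw => /negbTE. Qed.

Lemma disj_catl a b p : disj a b -> disj (a ++ p) b.
Proof.
move=> ab w; apply: contra (ab w).
by rewrite in_cone_cat => /andP[/andP[-> _] ->].
Qed.

Lemma disj_cat2 a b c : disj b c -> disj (a ++ b) (a ++ c).
Proof.
move=> bc w; rewrite !in_cone_cat; case: in_cone => //=; exact: bc.
Qed.

(** * The partial action on addresses *)

Lemma addr_act_comp g h a b c :
  addr_act h a b -> addr_act g b c -> addr_act (g \o h) a c.
Proof. by move=> hab gbc w /=; rewrite hab gbc. Qed.

Lemma addr_act_inv g h a b : cancel g h -> addr_act g a b -> addr_act h b a.
Proof. by move=> gK gab w; rewrite -gab gK. Qed.

Lemma addr_act_cat g a b p : addr_act g a b -> addr_act g (a ++ p) (b ++ p).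
Proof. by move=> gab w; rewrite !prepend_cat gab. Qed.

Lemma addr_act_in g a b w : addr_act g a b -> in_cone a w -> in_cone b (g w).
Proof. by move=> gab /in_coneP[u ->]; rewrite gab in_cone_prepend. Qed.

Lemma addr_act_preim g a b w : injective g -> addr_act g a b ->
  in_cone b (g w) -> in_cone a w.
Proof.
by move=> gI gab /in_coneP[u]; rewrite -gab => /gI ->; exact: in_cone_prepend.
Qed.

Lemma addr_act_out g a b w : injective g -> addr_act g a b ->
  in_cone b (g w) = in_cone a w.
Proof.
move=> gI gab; apply/idP/idP; [exact: addr_act_preim | exact: addr_act_in].
Qed.

(** * Swaps of two cones *)

Definition sw (a b : address) (w : cantor_space) : cantor_space :=
  if in_cone a w then prepend b (ltail (size a) w)
  else if in_cone b w then prepend a (ltail (size b) w) else w.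

Lemma sw_l a b : addr_act (sw a b) a b.
Proof. by move=> u; rewrite /sw in_cone_prepend ltail_prepend. Qed.

Lemma sw_r a b : disj a b -> addr_act (sw a b) b a.
Proof.
move=> ab u; rewrite /sw in_cone_prepend ltail_prepend.
by rewrite (disj_in (disjC ab)) // in_cone_prepend.
Qed.

Lemma sw_out a b w : ~~ in_cone a w -> ~~ in_cone b w -> sw a b w = w.
Proof. by rewrite /sw => /negbTE -> /negbTE ->. Qed.

Lemma sw_fix a b c : disj c a -> disj c b -> addr_act (sw a b) c c.
Proof.
move=> ca cb u; have cu := in_cone_prepend c u.
by rewrite sw_out ?(disj_in ca) ?(disj_in cb).
Qed.

Lemma sw_same a : sw a a = id.
Proof.
by apply/funext => w; rewrite /sw; case: (boolP (in_cone a w)) => // /prependK.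
Qed.

Lemma swK a b : disj a b -> involutive (sw a b).
Proof.
move=> ab w; case: (boolP (in_cone a w)) => [/in_coneP[u ->]|aw].
  by rewrite sw_l sw_r.
case: (boolP (in_cone b w)) => [/in_coneP[u ->]|bw]; first by rewrite sw_r ?sw_l.
by rewrite !sw_out.
Qed.

(** Injectivity of [x] pulls the tests for [a'] and [b'] back to [a] and [b]. With transitivity, one
    swap in [G] yields all those in the same orbit. *)
Lemma sw_conj x y a b a' b' : disj a b -> cancel x y -> cancel y x ->
  addr_act x a a' -> addr_act x b b' -> x \o sw a b \o y = sw a' b'.
Proof.
move=> ab xK yK xa xb; have xI := can_inj xK.
apply/funext => w /=; rewrite -{2}(yK w); move: (y w) => {}w.
rewrite /sw (addr_act_out _ xI xa) (addr_act_out _ xI xb).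
case: ifP => [/in_coneP[u ->]|_]; first by rewrite xa !ltail_prepend xb.
by case: ifP => [/in_coneP[u ->]|_] //; rewrite xb !ltail_prepend xa.
Qed.

Lemma prepend_half a u : prepend a u = prepend (rcons a (u 0)) (ltail 1 u).
Proof.
rewrite -cats1 prepend_cat; congr prepend; apply/funext => -[|n] //=.
by rewrite /prepend /ltail /= subn1 add1n.
Qed.

(** The letter following [a] or [b] is kept, so the two halves move independently. This makes a swap
    a double transposition of smaller cones, and replaces a pair that may cover the space by pairs
    that do not. *)
Lemma sw_split a b : disj a b ->
  sw a b = sw (rcons a false) (rcons b false) \o sw (rcons a true) (rcons b true).
Proof.
move=> ab; apply/funext => w /=; rewrite -!cats1.
have halves a' u : prepend a' u = prepend (a' ++ [:: u 0]) (ltail 1 u).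
  by rewrite cats1 -prepend_half.
have d (x y : bool) c : x != y -> disj (c ++ [:: x]) (c ++ [:: y]).
  move=> xy; apply: disj_cat2 => {}w; rewrite !in_cone1.
  by case: eqP => //= ->.
have ac x y : disj (a ++ [:: x]) (b ++ [:: y]).
  by apply/disj_catl/disjC/disj_catl/disjC.
have ca x y : disj (b ++ [:: x]) (a ++ [:: y]) by apply/disjC/ac.
case: (boolP (in_cone a w)) => [/in_coneP[u ->]|aw].
  rewrite sw_l (halves a) (halves b); case: (u 0).
    by rewrite sw_l sw_fix //; apply: d.
  by rewrite (@sw_fix _ _ (a ++ [:: false])) ?sw_l //; apply: d.
case: (boolP (in_cone b w)) => [/in_coneP[u ->]|bw].
  rewrite sw_r // (halves a) (halves b); case: (u 0).
    by rewrite sw_r // sw_fix //; apply: d.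
  by rewrite (@sw_fix _ _ (b ++ [:: false])) ?sw_r //; apply: d.
by rewrite !sw_out // !in_cone_cat (negbTE aw, negbTE bw).
Qed.

(** * Tilings by cones *)

(* A partition into cones; counting makes it visibly stable under permuting
   addresses and merging siblings. *)
Definition tiling (s : seq address) : Prop :=
  forall w, count (in_cone^~ w) s = 1.

Lemma tiling_uniq_in s a b w : tiling s -> a \in s -> b \in s ->
  in_cone a w -> in_cone b w -> a = b.
Proof.
move=> /(_ w) + sa sb aw bw; rewrite -size_filter.
have: a \in [seq c <- s | in_cone c w] by rewrite mem_filter aw.
have: b \in [seq c <- s | in_cone c w] by rewrite mem_filter bw.
by case: filter => [|c [|]] //; rewrite !inE => /eqP -> /eqP ->.
Qed.

Lemma tiling_disj s a b : tiling s -> a \in s -> b \in s -> a != b -> disj a b.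
Proof.
move=> ts sa sb ab w; apply: contra ab => /andP[aw bw].
by rewrite (tiling_uniq_in ts sa sb aw bw).
Qed.

Lemma tiling_cover s w : tiling s -> exists2 a, a \in s & in_cone a w.
Proof. by move=> /(_ w) ts; apply/hasP; rewrite has_count ts. Qed.

(** A repeated address would be counted twice at any word of its cone. *)
Lemma tiling_uniq s : tiling s -> uniq s.
Proof.
move=> ts; apply: count_mem_uniq => a.
case: (boolP (a \in s)) => [sa|/count_memPn //].
apply/eqP; rewrite /= eqn_leq -[X in _ && X]has_count has_pred1 sa andbT.
rewrite -(ts (prepend a zeros)); apply: sub_count => _ /eqP ->; exact: in_cone_prepend.
Qed.

Lemma tiling_perm s t : perm_eq s t -> tiling s -> tiling t.
Proof. by move=> /permP st ts w; rewrite -st. Qed.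

Lemma in_cone_rcons a w :
  in_cone (rcons a false) w + in_cone (rcons a true) w = in_cone a w.
Proof.
by rewrite -!cats1 !in_cone_cat !in_cone1; case: in_cone => //=; case: ltail.
Qed.

Lemma longest_mem (s : seq address) : s <> [::] ->
  exists2 a, a \in s & forall b, b \in s -> size b <= size a.
Proof.
case: s => // a s _; elim: s a => [|b s IH] a.
  by exists a; rewrite ?inE // => b; rewrite inE => /eqP ->.
have [c cs cmax] := IH b; case: (leqP (size a) (size c)) => ac.
  exists c => [|d]; first by rewrite inE cs orbT.
  by rewrite inE => /predU1P[-> //|]; apply: cmax.
exists a => [|d]; first by rewrite inE eqxx.
by rewrite inE => /predU1P[-> //|/cmax /leq_trans]; apply; apply: ltnW.
Qed.

(* The sibling of a longest address of a tiling also belongs to it. *)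
Lemma tiling_siblings s : tiling s -> 1 < size s ->
  exists r, rcons r false \in s /\ rcons r true \in s.
Proof.
move=> ts s1; have [a sa amax] : exists2 a, a \in s &
    forall b, b \in s -> size b <= size a.
  by apply: longest_mem => s0; rewrite s0 in s1.
have us := tiling_uniq ts.
case/lastP: a sa amax => [s0 amax|r x sa amax].
  have /(uniq_leq_size us) : {subset s <= [:: [::]]}.
    by move=> b /amax; rewrite leqn0 size_eq0 inE.
  by rewrite leqNgt s1.
(* As [a] is longest, [c] is a prefix of the sibling of [a]. A strict prefix would also be a prefix
   of [a], hence equal to [a] by uniqueness, which the lengths forbid. *)
have [c sc cw] := tiling_cover (prepend (rcons r (~~ x)) zeros) ts.
have := in_cone_prefix _ cw (in_cone_prepend _ _).
rewrite size_rcons -(size_rcons r x) => /(_ (amax _ sc)) /prefixP[d].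
case/lastP: d => [|d z].
  by rewrite cats0 => rc; exists r; move: sa sc; rewrite -rc; case: x {amax cw rc}.
rewrite -rcons_cat => /rcons_inj[rc _]; have cr : c = rcons r x.
  apply: (tiling_uniq_in (w := prepend (rcons r x) zeros) ts sc sa).
    by rewrite rc -cats1 -catA prepend_cat in_cone_prepend.
  exact: in_cone_prepend.
by have /eqP := congr1 size rc; rewrite cr size_cat size_rcons ltn_eqF // ltnS leq_addr.
Qed.

(** * Finite tables of elements of $V$, and generation by swaps *)

Definition table (v : cantor_space -> cantor_space) (L : seq (address * address)) :
    Prop :=
  [/\ {in L, forall p, addr_act v p.1 p.2}, tiling (unzip1 L) & tiling (unzip2 L)].

Lemma table_perm v L M : perm_eq L M -> table v L -> table v M.
Proof.
move=> LM [vL t1 t2]; split; first by move=> p; rewrite -(perm_mem LM) => /vL.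
  exact: tiling_perm (perm_map _ LM) t1.
exact: tiling_perm (perm_map _ LM) t2.
Qed.

Definition swap_addr (c t z : address) : address :=
  if z == c then t else if z == t then c else z.

Lemma swap_addrK c t : involutive (swap_addr c t).
Proof.
move=> z; rewrite /swap_addr; case: (eqVneq z c) => [->|zc].
  by case: (eqVneq t c); rewrite ?eqxx.
by case: (eqVneq z t) => [->|/negbTE zt]; rewrite ?eqxx // (negbTE zc) zt.
Qed.

Lemma swap_addr_l c t : swap_addr c t c = t.
Proof. by rewrite /swap_addr eqxx. Qed.

Lemma swap_addr_perm s c t : uniq s -> c \in s -> t \in s ->
  perm_eq s (map (swap_addr c t) s).
Proof.
move=> us sc st; have K := swap_addrK c t.
apply: uniq_perm => //; first by rewrite map_inj_uniq //; exact: inv_inj K.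
suff sub : {subset map (swap_addr c t) s <= s}.
  move=> z; apply/idP/idP => [sz|]; last exact: sub.
  by rewrite -(K z); exact/map_f/sub/map_f.
by move=> _ /mapP[z sz ->]; rewrite /swap_addr; case: ifP => // _; case: ifP.
Qed.

(** Taking [c] and [t] among the targets makes every other target disjoint from both, hence fixed by
    the swap. *)
Lemma table_sw v L c t : table v L -> c \in unzip2 L -> t \in unzip2 L ->
  table (sw c t \o v) [seq (p.1, swap_addr c t p.2) | p <- L].
Proof.
move=> [vL t1 t2] Lc Lt; split.
- move=> _ /mapP[[a b] Lab ->]; apply: (addr_act_comp (vL _ Lab)) => /=.
  have Lb : b \in unzip2 L by apply/mapP; exists (a, b).
  rewrite /swap_addr; case: (eqVneq b c) => [->|bc]; first exact: sw_l.
  case: (eqVneq b t) => [bt|bt].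
    by rewrite bt; apply: sw_r; rewrite -bt; apply: tiling_disj (t2) _ _ _;
      rewrite // eq_sym.
  by apply: sw_fix; apply: tiling_disj (t2) _ _ _.
- by rewrite /unzip1 -map_comp.
- apply: tiling_perm (t2).
  rewrite /unzip2 -map_comp (map_comp (swap_addr c t) snd).
  exact: swap_addr_perm (tiling_uniq t2) Lc Lt.
Qed.

Lemma table_merge v r t L :
  table v [:: (rcons r false, rcons t false), (rcons r true, rcons t true) & L] ->
  table v ((r, t) :: L).
Proof.
move=> [vL t1 t2]; split.
- move=> p; rewrite inE => /predU1P[->|Lp] w /=; last first.
    by apply: vL; rewrite !inE Lp !orbT.
  rewrite (prepend_half r) (prepend_half t); case: (w 0).
    by rewrite (vL (rcons r true, rcons t true)) // !inE eqxx orbT.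
  by rewrite (vL (rcons r false, rcons t false)) // !inE eqxx.
- by move=> w; rewrite -(t1 w) /= addnA in_cone_rcons.
- by move=> w; rewrite -(t2 w) /= addnA in_cone_rcons.
Qed.

Lemma mem_unzip1 (T U : eqType) (L : seq (T * U)) x :
  x \in unzip1 L -> exists y, perm_eq L ((x, y) :: rem (x, y) L).
Proof. by case/mapP => -[a y] Lay -> /=; exists y; apply: perm_to_rem. Qed.

Lemma table_siblings v L : table v L -> 1 < size L ->
  exists r c d M, perm_eq L [:: (rcons r false, c), (rcons r true, d) & M].
Proof.
move=> [_ t1 _] L1; have [r [r0 r1]] : exists r,
    rcons r false \in unzip1 L /\ rcons r true \in unzip1 L.
  by apply: tiling_siblings; rewrite ?size_map.
have [c Lc] := mem_unzip1 r0; set M := rem _ L in Lc.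
have : rcons r true \in unzip1 ((rcons r false, c) :: M).
  by rewrite -(perm_mem (perm_map _ Lc)).
rewrite inE /= => /predU1P[/rcons_inj//|/mem_unzip1[d Md]].
exists r, c, d, (rem (rcons r true, d) M); apply: perm_trans Lc _.
by rewrite perm_cons.
Qed.

(** Induction on the length of the table. Two sibling sources go to targets [c] and [d]; two swaps
    send these to sibling targets, and merging shortens the table. Swaps are involutions, so closure
    under composition suffices to undo them. *)
Lemma swaps_generate (G : set (cantor_space -> cantor_space)) :
  G id -> (forall g h, G g -> G h -> G (g \o h)) ->
  (forall a b, disj a b -> G (sw a b)) ->
  forall v L, table v L -> G v.
Proof.
move=> G1 GM Gsw v L; move: {2}(size L) (leqnn (size L)) => n.
have Gsw2 s c t : tiling s -> c \in s -> t \in s ->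
    G (sw c t) /\ involutive (sw c t).
  move=> ts sc st; case: (eqVneq c t) => [->|ct]; first by rewrite sw_same.
  have ctd := tiling_disj ts sc st ct.
  by split; [exact: Gsw | exact: swK].
have Gcancel s c t u : tiling s -> c \in s -> t \in s -> G (sw c t \o u) -> G u.
  move=> ts sc st Gu; have [Gct K] := Gsw2 _ _ _ ts sc st.
  have -> : u = sw c t \o (sw c t \o u) by apply/funext => w /=; rewrite K.
  exact: GM.
elim: n L v => [|n IH] L v Ln tL.
  case: L Ln tL => // _ [_ /(_ zeros)] //.
case: (leqP (size L) 1) => L1.
  case: L {Ln} L1 tL => [|[a b] [|//]] _ [vL t1 t2]; first by move: (t1 zeros).
  (* The constant word [~~ x] avoids every cone whose address starts with [x]. *)
  have nil c : tiling [:: c] -> c = [::].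
    move=> tc; have cover w : in_cone c w by have := tc w; rewrite /= addn0; case: in_cone.
    case: c {tc} cover => // x c /(_ (fun=> ~~ x)) /in_coneP[u] /(congr1 (@^~ 0)).
    by rewrite /prepend /=; case: x.
  suff -> : v = id by [].
  apply/funext => w; have := vL (a, b) (mem_head _ _) w.
  by rewrite /= (nil a t1) (nil b t2) prepend_nil.
have [r [c [d [M LM]]]] := table_siblings tL L1.
have {}tL := table_perm LM tL.
have [_ _ t2] := tL.
have [t [t0 t1]] := tiling_siblings t2 isT.
set B := unzip2 _ in t2 t0 t1.
have Bc : c \in B by rewrite inE eqxx.
apply: (Gcancel B c (rcons t false)) => //.
have tL' := table_sw tL Bc t0.
have [_ _ t2'] := tL'.
have {t1} : rcons t true \in unzip2
    [seq (p.1, swap_addr c (rcons t false) p.2) |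
       p <- [:: (rcons r false, c), (rcons r true, d) & M]].
  rewrite /unzip2 -map_comp (map_comp (swap_addr c (rcons t false)) snd).
  by rewrite -(perm_mem (swap_addr_perm (tiling_uniq t2) Bc t0)).
move: tL' t2'; rewrite /= swap_addr_l.
set d' := swap_addr c _ d; set M' := map _ M.
set B' := rcons t false :: _ => tL' t2' t1.
have B'd : d' \in B' by rewrite !inE eqxx orbT.
apply: (Gcancel B' d' (rcons t true)) => //.
(* The second swap leaves [rcons t false] in place: it differs from [d'] because targets are
   distinct, and from [rcons t true] by its last letter. *)
have := table_sw tL' B'd t1; rewrite /= swap_addr_l {1}/swap_addr.
have := tiling_uniq t2'; rewrite /B' /= inE negb_or => /andP[/andP[/negbTE -> _] _].
rewrite (inj_eq (@rcons_injr _ t)) /= => /table_merge; apply: IH.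
by move: Ln; rewrite (perm_size LM) /= !size_map.
Qed.

(** * From partitions and [Sigma] to tilings and proper pairs *)

Lemma disj_prefix a b : ~~ prefix a b -> ~~ prefix b a -> disj a b.
Proof.
move=> ab ba w; apply/negP => /andP[aw bw].
have [/in_cone_prefix l|/ltnW /in_cone_prefix l] := leqP (size a) (size b).
  by rewrite (l w) in ab.
by rewrite (l w) in ba.
Qed.

Lemma coneE a w : cone a w <-> in_cone a w.
Proof.
by split=> [[u _ <-]|/in_coneP[u ->]]; [exact: in_cone_prepend | exists u].
Qed.

Lemma partition_tiling n (a : 'I_n -> address) :
  partition setT (cone \o a) setT -> tiling [seq a i | i <- enum 'I_n].
Proof.
move=> [cov triv _] w.
have : cover setT (cone \o a) w by rewrite cov.
case=> i _ /coneE iw; rewrite count_map (@eq_count _ _ (pred1 i)).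
  by rewrite count_uniq_mem ?enum_uniq // mem_enum.
move=> j /=; apply/idP/eqP => [jw|-> //].
by apply: triv => //; exists w; split; apply/coneE.
Qed.

Lemma thompsonV_table g : thompsonV g -> exists L, table g L.
Proof.
move=> [n [a [b [pa pb gab]]]]; exists [seq (a i, b i) | i <- enum 'I_n]; split.
- by move=> _ /mapP[i _ ->]; exact: gab.
- by rewrite /unzip1 -map_comp; exact: partition_tiling.
- by rewrite /unzip2 -map_comp; exact: partition_tiling.
Qed.

(** Far enough along the zeros after [c], the address extends a source of the table, where [g] only
    replaces a prefix. *)
Lemma thompsonV_act_deep g c N : thompsonV g ->
  exists q e, [/\ N <= size q, N <= size e & addr_act g (c ++ q) e].
Proof.
move=> /thompsonV_table[L [gL t1 _]].
have [a /mapP[[a' b] Lab ->] /= aw] := tiling_cover (prepend c zeros) t1.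
(* The length [size a'] makes [a'] a prefix of [c ++ q]; the extra [N] leaves a suffix [s] of length
   at least [N], which bounds the image from below. *)
pose q := nseq (size a' + N) false.
have zq : prepend q zeros = zeros.
  by apply/funext => i; rewrite /prepend nth_nseq; case: ifP => // _; case: ifP.
have /prefixP[s cqs] : prefix a' (c ++ q).
  apply: in_cone_prefix aw _.
    by rewrite size_cat size_nseq addnCA leq_addr.
  by rewrite -[in X in prepend _ X]zq -prepend_cat in_cone_prepend.
exists q, (b ++ s); split; first by rewrite size_nseq leq_addl.
  have := congr1 size cqs; rewrite !size_cat size_nseq addnCA => /addnI <-.
  by rewrite addnA leq_addl.
by rewrite cqs; apply: addr_act_cat; exact: gL Lab.
Qed.

Definition proper_pair (a b : address) : Prop :=
  disj a b /\ exists w, ~~ in_cone a w /\ ~~ in_cone b w.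

Lemma proper_pair_disj a b c : disj a b -> disj c a -> disj c b -> proper_pair a b.
Proof.
move=> ab ca cb; split=> //; exists (prepend c zeros).
by rewrite (disj_in ca) ?(disj_in cb) // in_cone_prepend.
Qed.

Lemma Sigma2 a b : proper_pair a b ->
  Sigma (fun i : 'I_2 => if i == ord0 then a else b).
Proof.
move=> [ab [w [aw bw]]]; split.
  move=> [[|[|//]] ip] [[|[|//]] jp] _ _ [u] /= [/coneE iu /coneE ju];
    try exact: val_inj; by have := ab u; rewrite iu ju.
move=> cov.
have : (\bigcup_(i in setT) cone (if i == ord0 :> 'I_2 then a else b))%classic w.
  by rewrite cov.
by case=> [i _ /coneE]; case: ifP => _; apply/negP.
Qed.

(** * From two-fold to three-fold transitivity *)

Section TwoTransitive.
Variable G : set (cantor_space -> cantor_space).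
Hypothesis hG : subgroup_of_V G.
Hypothesis htrans : transitive_on_proper_cones 2 G.

Let GV : forall g, G g -> thompsonV g.
Proof. by case: hG. Qed.

Let G1 : G id.
Proof. by case: hG. Qed.

Let GM g h : G g -> G h -> G (g \o h).
Proof. by case: hG => _ _ + _; apply. Qed.

Let Ginv g : G g -> exists2 h, G h & cancel g h /\ cancel h g.
Proof. by case: hG => _ _ _; apply. Qed.

Lemma G_inj g : G g -> injective g.
Proof. by move=> /Ginv[h _ [/can_inj]]. Qed.

Lemma trans2 a b a' b' : proper_pair a b -> proper_pair a' b' ->
  exists2 g, G g & addr_act g a a' /\ addr_act g b b'.
Proof.
move=> /Sigma2 ab /Sigma2 ab'; have [g Gg gab] := htrans ab ab'.
by exists g => //; split; [exact: (gab ord0) | exact: (gab (lift ord0 ord0))].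
Qed.

(** Conjugation reduces to [c] being the cone 1. There, an element sending the pair (0, 1p) to (0,
    1p') is the identity on the cone 0, the complement of 1. *)
Lemma trans_inside c p p' : c <> [::] -> p <> [::] -> p' <> [::] ->
  exists2 g, G g &
    addr_act g (c ++ p) (c ++ p') /\ forall w, ~~ in_cone c w -> g w = w.
Proof.
move=> c0 p0 p0'.
have ok1 q : q <> [::] -> proper_pair [:: false] ([:: true] ++ q).
  case: q => // x q _; apply: (@proper_pair_disj _ _ [:: true; ~~ x]);
    by apply: disj_prefix; case: x.
(* A companion cone, needed only to move [c] by two-fold transitivity. *)
have [d cd] : exists d, proper_pair c d.
  case: c c0 => // x c _; exists [:: ~~ x; false].
  apply: (@proper_pair_disj _ _ [:: ~~ x; true]);
    by apply: disj_prefix; case: x.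
have [x Gx [xc _]] : exists2 g, G g &
    addr_act g c [:: true] /\ addr_act g d [:: false; false].
  apply: trans2 => //; apply: (@proper_pair_disj _ _ [:: false; true]);
    exact: disj_prefix.
have [y Gy [xK yK]] := Ginv Gx.
have [k Gk [k0 k1]] := trans2 (ok1 _ p0) (ok1 _ p0').
exists (y \o (k \o x)); first by apply: GM => //; exact: GM.
split.
  apply: (@addr_act_comp _ _ _ ([:: true] ++ p')).
    exact: addr_act_comp (addr_act_cat p xc) k1.
  exact: (addr_act_cat p' (addr_act_inv xK xc)).
move=> w cw /=; have : in_cone [:: false] (x w).
  have := cw; rewrite -(addr_act_out w (G_inj Gx) xc) !in_cone1.
  by case: (x w 0).
by case/in_coneP=> u xw; rewrite xw k0 -xw xK.
Qed.

Local Notation O := false.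
Local Notation I := true.

(* [b] can be shrunk and moved inside the larger cone [r] without disturbing
   [a] and [c]. *)
Definition free_triple (a b c : address) : Prop :=
  exists r p, [/\ b = r ++ p, p <> [::], proper_pair a c, disj r a & disj r c].

(** An [x] sending [a], [c] to 0, 10 maps the cone [r] into 11, and some deep subcone of [r] onto a
    cone [e] inside 11. Moving [b] to that subcone within [r] beforehand, and [e] to 110 within 11
    afterwards, disturbs neither of the other two cones. *)
Lemma trans3 a b c : free_triple a b c ->
  exists2 g, G g & [/\ addr_act g a [:: O], addr_act g b [:: I; I; O]
                     & addr_act g c [:: I; O]].
Proof.
move=> [r [p [-> p0 ac ra rc]]].
have r0 : r <> [::].
  by move=> r0; have := ra (prepend a zeros); rewrite r0 in_cone_prepend.
have [x Gx [xa xc]] : exists2 g, G g & addr_act g a [:: O] /\ addr_act g c [:: I; O].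
  by apply: trans2 => //; apply: (@proper_pair_disj _ _ [:: I; I]); exact: disj_prefix.
have xI := G_inj Gx.
(* Since [e] misses 0 and 10, it starts with 11; length at least 3 makes the rest [f] nonempty, as
   [trans_inside] requires. *)
have [q [e [q3 e3 xq]]] := thompsonV_act_deep r 3 (GV Gx).
have [f f0 ef] : exists2 f, f <> [::] & e = [:: I; I] ++ f.
  have eout z d : disj r d -> addr_act x d z -> in_cone z (prepend e zeros) = false.
    move=> rd xd; rewrite -xq (addr_act_out _ xI xd).
    by apply: (disj_in rd); rewrite prepend_cat in_cone_prepend.
  have := eout _ _ ra xa; have := eout _ _ rc xc.
  case: e e3 {xq eout} => [|e0 [|e1 [|e2 e]]] // _.
  rewrite /in_cone /mkseq /=.
  by case: e0; case: e1 => //; exists (e2 :: e).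
have q0 : q <> [::] by case: q q3 {xq}.
have [k Gk [kp kout]] := trans_inside r0 p0 q0.
have cons0 (z : bool) s : z :: s <> [::] by [].
have [y Gy [yf yout]] := trans_inside (cons0 I [:: I]) f0 (cons0 O [::]).
exists (y \o (x \o k)); first by apply: GM => //; exact: GM.
have kfix d : disj r d -> addr_act k d d.
  by move=> rd w; rewrite kout // (disj_in (disjC rd)) // in_cone_prepend.
have yfix d : disj d [:: I; I] -> addr_act y d d.
  by move=> dI w; rewrite yout // (disj_in dI) // in_cone_prepend.
split.
- apply: (@addr_act_comp _ _ _ [:: O]); last exact/yfix/disj_prefix.
  exact: addr_act_comp (kfix _ ra) xa.
- apply: (@addr_act_comp _ _ _ e); last by rewrite ef.
  exact: addr_act_comp kp xq.
- apply: (@addr_act_comp _ _ _ [:: I; O]); last exact/yfix/disj_prefix.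
  exact: addr_act_comp (kfix _ rc) xc.
Qed.

Lemma trans3_free a b c a' b' c' : free_triple a b c -> free_triple a' b' c' ->
  exists2 g, G g & [/\ addr_act g a a', addr_act g b b' & addr_act g c c'].
Proof.
move=> /trans3[x Gx [xa xb xc]] /trans3[y Gy [ya yb yc]].
have [z Gz [yK _]] := Ginv Gy.
exists (z \o x); first exact: GM.
split; [apply: addr_act_comp xa _ | apply: addr_act_comp xb _ |
  apply: addr_act_comp xc _]; exact: addr_act_inv yK _.
Qed.

Lemma swap3_free a b c : free_triple a b c ->
  exists2 g, G g & [/\ addr_act g a b, addr_act g b a & addr_act g c c].
Proof.
move=> abc.
(* Each of the first two cones of (00, 110, 10) can be shrunk, so this triple
   is equivalent to [a, b, c] in both orders. *)
have f1 : free_triple [:: O; O] [:: I; I; O] [:: I; O].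
  exists [:: I; I], [:: O]; split=> //; try exact: disj_prefix.
  by apply: (@proper_pair_disj _ _ [:: O; I]); exact: disj_prefix.
have f2 : free_triple [:: I; I; O] [:: O; O] [:: I; O].
  exists [:: O], [:: O]; split=> //; try exact: disj_prefix.
  by apply: (@proper_pair_disj _ _ [:: I; I; I]); exact: disj_prefix.
have [x Gx [xa xb xc]] := trans3_free abc f1.
have [y Gy [ya yb yc]] := trans3_free f2 abc.
exists (y \o x); first exact: GM.
by split; [exact: addr_act_comp xa yb | exact: addr_act_comp xb ya |
  exact: addr_act_comp xc yc].
Qed.

(** * A 3-cycle of cones in [G] *)

Lemma free_11_100_00 : free_triple [:: I; I] [:: I; O; O] [:: O; O].
Proof.
exists [:: I; O], [:: O]; split=> //; try exact: disj_prefix.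
by apply: (@proper_pair_disj _ _ [:: O; I]); exact: disj_prefix.
Qed.

(* The commutator of an element swapping 11 and 100 and fixing 0 with one
   swapping 11 and 00 and fixing 10: their uncontrolled parts are supported in
   the disjoint cones 101 and 01, so they cancel. *)
Lemma G_cycle0 : G (sw [:: I; I] [:: I; O; O] \o sw [:: I; O; O] [:: O; O]).
Proof.
have [g Gg [gab gba gc]] : exists2 g, G g &
    [/\ addr_act g [:: I; I] [:: I; O; O], addr_act g [:: I; O; O] [:: I; I]
      & addr_act g [:: O] [:: O]].
  apply: swap3_free; exists [:: I; O], [:: O]; split=> //; try exact: disj_prefix.
  by apply: (@proper_pair_disj _ _ [:: I; O; I]); exact: disj_prefix.
have [h Gh [hab hba hc]] : exists2 g, G g &
    [/\ addr_act g [:: I; I] [:: O; O], addr_act g [:: O; O] [:: I; I]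
      & addr_act g [:: I; O] [:: I; O]].
  apply: swap3_free; exists [:: O], [:: O]; split=> //; try exact: disj_prefix.
  by apply: (@proper_pair_disj _ _ [:: O; I]); exact: disj_prefix.
(* The injective map [g] permutes the cones 11, 100 and 0, so it cannot leave the remaining cone
   101. *)
have gstab w : in_cone [:: I; O; I] w -> in_cone [:: I; O; I] (g w).
  have gI := G_inj Gg; move: (addr_act_out w gI gab) (addr_act_out w gI gba).
  move: (addr_act_out w gI gc); rewrite /in_cone /mkseq /=.
  by case: (w 0); case: (w 1); case: (w 2); case: (g w 0); case: (g w 1); case: (g w 2).
have hstab w : in_cone [:: O; I] w -> in_cone [:: O; I] (h w).
  have hI := G_inj Gh; move: (addr_act_out w hI hab) (addr_act_out w hI hba).
  move: (addr_act_out w hI hc); rewrite /in_cone /mkseq /=.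
  by case: (w 0); case: (w 1); case: (h w 0); case: (h w 1).
set T := _ \o _.
have [g' Gg' [gK g'K]] := Ginv Gg; have [h' Gh' [hK h'K]] := Ginv Gh.
(* This says that [T] is the commutator of [g] and [h], in a form free of inverses that can be
   checked cone by cone. *)
suff TE w : g (h w) = T (h (g w)).
  have -> : T = (g \o h) \o (g' \o h').
    by apply/funext => w /=; rewrite TE g'K h'K.
  by apply: GM; exact: GM.
have gfix v : in_cone [:: O] v -> g v = v by case/in_coneP=> u ->; exact: gc.
have hfix v : in_cone [:: I; O] v -> h v = v by case/in_coneP=> u ->; exact: hc.
have Tab : addr_act T [:: I; I] [:: I; O; O].
  by apply: addr_act_comp (sw_l _ _); apply: sw_fix; exact: disj_prefix.
have Tbc : addr_act T [:: I; O; O] [:: O; O].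
  by apply: addr_act_comp (sw_l _ _) _; apply: sw_fix; exact: disj_prefix.
have Tca : addr_act T [:: O; O] [:: I; I].
  by apply: (addr_act_comp (sw_r _) (sw_r _)); exact: disj_prefix.
have Tfix v : in_cone [:: I; O; I] v || in_cone [:: O; I] v -> T v = v.
  move=> vJ; suff : [&& ~~ in_cone [:: I; I] v, ~~ in_cone [:: I; O; O] v
      & ~~ in_cone [:: O; O] v].
    by case/and3P=> va vb vc; rewrite /T /= !sw_out.
  move: vJ; rewrite /in_cone /mkseq /=.
  by case: (v 0); case: (v 1); case: (v 2).
have sub101 v : in_cone ([:: I; O] ++ [:: I]) v -> in_cone [:: I; O] v.
  by rewrite in_cone_cat => /andP[].
have sub01 v : in_cone ([:: O] ++ [:: I]) v -> in_cone [:: O] v.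
  by rewrite in_cone_cat => /andP[].
have : [|| in_cone [:: I; I] w, in_cone [:: I; O; O] w, in_cone [:: O; O] w,
    in_cone [:: I; O; I] w | in_cone [:: O; I] w].
  by rewrite /in_cone /mkseq /=; case: (w 0); case: (w 1); case: (w 2).
case/or4P => [/in_coneP[u ->]|/in_coneP[u ->]|/in_coneP[u ->]|/orP[w1|w1]].
- by rewrite hab gab gfix ?hfix ?Tbc.
- by rewrite hfix // gba hab Tca.
- by rewrite hba gab gfix // hba Tab.
(* On 101 both [h] and [T] are the identity and [g] stays inside, so both sides equal [g w]; on 01
   the roles of [g] and [h] are exchanged. *)
- by rewrite hfix ?sub101 // hfix ?Tfix ?sub101 ?gstab.
- by rewrite (gfix w) ?sub01 // gfix ?Tfix ?sub01 ?hstab ?orbT.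
Qed.

(** * From 3-cycles to all swaps *)

Lemma G_cycle a b c : free_triple a b c -> disj a b -> disj b c ->
  G (sw a b \o sw b c).
Proof.
move=> abc ab bc.
have [x Gx [xa xb xc]] := trans3_free free_11_100_00 abc.
have [y Gy [xK yK]] := Ginv Gx.
have -> : sw a b \o sw b c = x \o (sw [:: I; I] [:: I; O; O] \o
    sw [:: I; O; O] [:: O; O]) \o y.
  rewrite -(sw_conj _ xK yK xa xb) -?(sw_conj _ xK yK xb xc); try exact: disj_prefix.
  by apply/funext => w /=; rewrite xK.
by apply: GM => //; apply: GM => //; exact: G_cycle0.
Qed.

(** The swap splits into a double transposition of four cones. Inserting the swap of 100 and 001
    twice turns it into a product of two 3-cycles, both on free triples. *)
Lemma G_sw0 : G (sw [:: O; O] [:: I; O]).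
Proof.
rewrite sw_split; last exact: disj_prefix.
rewrite /=.
have -> : sw [:: O; O; O] [:: I; O; O] \o sw [:: O; O; I] [:: I; O; I] =
  (sw [:: O; O; O] [:: I; O; O] \o sw [:: I; O; O] [:: O; O; I]) \o
  (sw [:: I; O; O] [:: O; O; I] \o sw [:: O; O; I] [:: I; O; I]).
  by apply/funext => w /=; rewrite swK //; exact: disj_prefix.
apply: GM; apply: G_cycle; try exact: disj_prefix.
- exists [:: I; O], [:: O]; split=> //; try exact: disj_prefix.
  by apply: (@proper_pair_disj _ _ [:: I]); exact: disj_prefix.
- exists [:: O; O], [:: I]; split=> //; try exact: disj_prefix.
  by apply: (@proper_pair_disj _ _ [:: I; I]); exact: disj_prefix.
Qed.

Lemma G_sw_proper a b : proper_pair a b -> G (sw a b).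
Proof.
move=> ab; have [x Gx [xa xb]] : exists2 g, G g &
    addr_act g [:: O; O] a /\ addr_act g [:: I; O] b.
  by apply: trans2 => //; apply: (@proper_pair_disj _ _ [:: I; I]); exact: disj_prefix.
have [y Gy [xK yK]] := Ginv Gx.
rewrite -(sw_conj _ xK yK xa xb); last exact: disj_prefix.
by apply: GM => //; apply: GM => //; exact: G_sw0.
Qed.

Lemma G_sw a b : disj a b -> G (sw a b).
Proof.
move=> ab; rewrite sw_split //.
have half x : proper_pair (rcons a x) (rcons b x).
  (* The other half of [a] is a cone missed by both, even when [a] and [b] cover the space. *)
  rewrite -!cats1; apply: (@proper_pair_disj _ _ (a ++ [:: ~~ x])).
  - exact/disj_catl/disjC/disj_catl/disjC.
  - by apply: disj_cat2; apply: disj_prefix; case: x.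
  - exact/disj_catl/disjC/disj_catl/disjC.
by apply: GM; exact: G_sw_proper.
Qed.

End TwoTransitive.

Theorem theorem8p4 (G : set (cantor_space -> cantor_space))
    (hG : subgroup_of_V G) (htrans : transitive_on_proper_cones 2 G) :
  G = thompsonV.
Proof.
have [GV G1 GM _] := hG.
apply/seteqP; split=> [//|v /thompsonV_table[L]].
exact: (swaps_generate G1 GM (G_sw hG htrans)).
Qed.
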